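(* Let $C \subseteq \mathbb{R}^n$ be a nonempty closed convex set whose recession cone $0^{+}C$ is polyhedral. Then $C$ is approximately M-decomposable if and only if $C$ is hyperbolic.
   Context: $B$ denotes the closed Euclidean unit ball of $\mathbb{R}^n$ and $M+P$ the Minkowski sum of sets. For a nonempty closed convex set $C \subseteq \mathbb{R}^n$: - the recession cone is $0^{+}C = \{d \in \mathbb{R}^n : x + \mu d \in C \text{ for all } x \in C,\ \mu \geq 0\}$; - for $r > 0$ the truncation of $C$ of radius $r$ is $C_r = (C \cap rB) + 0^{+}C$ (empty if $C \cap rB$ is empty); - $C$ is called approximately M-decomposable if for every $\varepsilon > 0$ there exists $r > 0$ such that $C \subseteq C_r + \varepsilon B$; - $C$ is called hyperbolic if there exists a compact convex set $M \subseteq \mathbb{R}^n$ such that $C \subseteq M + 0^{+}C$. A set is polyhedral if it is the intersection of finitely many closed half-spaces. *)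

(* Defs.v *)
From mathcomp Require Import all_boot all_order all_algebra.
From mathcomp Require Import all_classical all_reals all_analysis.

Set Implicit Arguments.
Unset Strict Implicit.
Unset Printing Implicit Defensive.

Import Order.TTheory GRing.Theory Num.Theory.
Import numFieldNormedType.Exports.

Local Open Scope classical_set_scope.
Local Open Scope ring_scope.

(* R^n is 'rV[R]_n. The library norm `|x| on row vectors is the max norm, so
   the Euclidean norm is defined here. Both norms induce the same topology, so
   the library's [closed] and [compact] are the usual notions. *)

Definition dotv (R : realType) (n : nat) (x y : 'rV[R]_n) : R :=
  \sum_(i < n) x 0 i * y 0 i.

Definition enorm (R : realType) (n : nat) (x : 'rV[R]_n) : R :=
  Num.sqrt (dotv x x).

Definition unit_eball (R : realType) (n : nat) : set 'rV[R]_n :=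
  [set x | enorm x <= 1].

Definition msum (R : realType) (n : nat) (A D : set 'rV[R]_n) : set 'rV[R]_n :=
  [set x + y | x in A & y in D].

Definition scale_set (R : realType) (n : nat) (r : R) (A : set 'rV[R]_n) :
    set 'rV[R]_n :=
  [set r *: x | x in A].

Definition recession_cone (R : realType) (n : nat) (C : set 'rV[R]_n) :
    set 'rV[R]_n :=
  [set d | forall (x : 'rV[R]_n) (mu : R), C x -> 0 <= mu -> C (x + mu *: d)].

Definition truncation (R : realType) (n : nat) (C : set 'rV[R]_n) (r : R) :
    set 'rV[R]_n :=
  msum (C `&` scale_set r (@unit_eball R n)) (recession_cone C).

Definition approx_M_decomposable (R : realType) (n : nat) (C : set 'rV[R]_n) :
    Prop :=
  forall e : R, 0 < e ->
    exists2 r : R, 0 < r &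
      C `<=` msum (truncation C r) (scale_set e (@unit_eball R n)).

Definition hyperbolic (R : realType) (n : nat) (C : set 'rV[R]_n) : Prop :=
  exists M : set 'rV[R]_n,
    [/\ compact M, convex_set M & C `<=` msum M (recession_cone C)].

Definition halfspace (R : realType) (n : nat) (a : 'rV[R]_n) (b : R) :
    set 'rV[R]_n :=
  [set x | dotv a x <= b].

(* m = 0 is allowed: the whole space is the intersection of no half-space. *)
Definition polyhedral (R : realType) (n : nat) (P : set 'rV[R]_n) : Prop :=
  exists (m : nat) (a : 'I_m -> 'rV[R]_n) (b : 'I_m -> R),
    (forall i, a i != 0) /\ P = \bigcap_(i in [set: 'I_m]) halfspace (a i) (b i).

(* Main.v *)
(* Approximate M-decomposability with e = 1 gives C <= (r + 1)B + 0+C, which is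
   hyperbolicity. Conversely, let 0+C = {d | <a_i, d> <= 0 for all i} and let M
   be compact with C <= M + 0+C, so that every -<a_i, .> is bounded below on C.
   If e > 0 defeats every radius, pick x_k in C outside C_(k+1) + eB. Up to a
   subsequence, each -<a_i, x_k> is nondecreasing up to an error d, so
   <a_i, x_k - x_0> <= d for all i. By Hoffman's bound x_k - x_0 lies within
   c d <= e of 0+C, and this contradicts the choice of x_k as soon as
   k >= |x_0|. *)
Require Import Defs.
From mathcomp Require Import all_boot all_order all_algebra.
From mathcomp Require Import all_classical all_reals all_analysis.
From mathcomp Require Import ring lra.

Import Order.TTheory GRing.Theory Num.Theory.
Import numFieldNormedType.Exports.

Local Open Scope classical_set_scope.
Local Open Scope ring_scope.

(** * Almost nondecreasing subsequences of sequences bounded below *)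

Lemma almost_minimal_index (R : realType) (u : nat -> R) (b d : R) :
  (forall k, b <= u k) -> 0 < d ->
  forall N, exists2 p, (N <= p)%N & forall q, (p <= q)%N -> u p <= u q + d.
Proof.
move=> ub d0 N; set A := [set u q | q in [set q | (N <= q)%N]].
have Alb : has_lbound A by exists b => _ [q _ <-].
have A0 : A !=set0 by exists (u N), N => /=.
(* [u p] is within [d] of the infimum of the tail from [N], a lower bound for all later terms. *)
have [_ [p Np <-] pA] := inf_adherent d0 (conj A0 Alb).
exists p => // q pq; apply: (le_trans (ltW pA)); rewrite lerD2r.
by apply: ge_inf => //; exists q => //=; apply: leq_trans pq.
Qed.

(** Each index is almost minimal among all later ones, so errors do not add up along the
    subsequence. *)
Lemma almost_nondecreasing_subseq (R : realType) (u : nat -> R) (b d : R) :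
  (forall k, b <= u k) -> 0 < d ->
  exists2 f : nat -> nat, {homo f : j k / (j < k)%N} &
    forall j k, (j < k)%N -> u (f j) <= u (f k) + d.
Proof.
move=> ub d0; have /choice[g gP] : forall N, exists p, (N <= p)%N /\
    forall q, (p <= q)%N -> u p <= u q + d.
  by move=> N; have [p] := almost_minimal_index R u b d ub d0 N; exists p.
have gN N : (N <= g N)%N by case: (gP N).
pose f := fix f k := if k is k'.+1 then g (f k').+1 else g 0%N.
have f_homo : {homo f : j k / (j < k)%N}.
  by apply: homo_ltn ltn_trans _ => k; exact: gN.
exists f => // j k jk.
have [N fjE] : exists N, f j = g N by case: (j) => [|j']; eexists.
by rewrite fjE; apply: (gP N).2; rewrite -fjE ltnW// f_homo.
Qed.

(** The inequality for all pairs survives further extraction, so the indices in [s] are treated one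
    by one. *)
Lemma almost_nondecreasing_common_subseq (R : realType) (I : eqType)
    (u : I -> nat -> R) (b d : R) (s : seq I) :
  (forall i k, b <= u i k) -> 0 < d ->
  exists2 f : nat -> nat, {homo f : j k / (j < k)%N} &
    forall i j k, i \in s -> (j < k)%N -> u i (f j) <= u i (f k) + d.
Proof.
move=> ub d0; elim: s => [|i s [f f_homo fs]]; first by exists id.
have [g g_homo gi] := almost_nondecreasing_subseq R (u i \o f) b d
  (fun k => ub i (f k)) d0.
exists (f \o g) => [j k /g_homo/f_homo//|i' j k].
by rewrite inE => /predU1P[-> /gi//|i's /g_homo jk]; exact: fs.
Qed.

(** * Hoffman's bound for linear inequalities *)

Lemma nondecreasing_sets_stabilize (T : finType) (F : nat -> {set T}) :
  (forall k, F k \subset F k.+1) -> exists2 k, (k <= #|T|)%N & F k = F k.+1.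
Proof.
move=> F_mono; apply: contrapT => F_neq.
(* Without a repetition every step gains an element, and [F #|T|.+1] becomes too large. *)
have F_card k : (k <= #|T|.+1 -> k <= #|F k|)%N.
  elim: k => // k IH kT; apply: leq_ltn_trans (IH (ltnW kT)) _.
  apply: proper_card; rewrite finset.properEneq F_mono andbT.
  by apply/eqP => FkE; apply: F_neq; exists k.
have := leq_trans (F_card _ (leqnn _)) (max_card (F #|T|.+1)).
by rewrite ltnn.
Qed.

Lemma row_mulmx_bound (R : realType) (m n : nat) (v : 'rV[R]_m)
    (B : 'M[R]_(m, n)) (c : R) :
  (forall j, `|v 0 j| <= c) ->
  \sum_i `|(v *m B) 0 i| <= c * \sum_i \sum_j `|B j i|.
Proof.
move=> vc; rewrite mulr_sumr; apply: ler_sum => i _.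
rewrite mxE mulr_sumr; apply: le_trans (ler_norm_sum _ _ _) _.
by apply: ler_sum => j _; rewrite normrM ler_wpM2r.
Qed.

(* Hoffman's bound. The corrector w is obtained by solving the equations
   w a_j = z a_j, for j in a set J of constraints, with a pseudo-inverse; this
   w is controlled by the right-hand sides. J consists of the constraints with
   z a_j >= - C^k d, where k is such that no value z a_i lies in
   [- C^(k+1) d, - C^k d); the other constraints then have enough slack. *)
Lemma hoffman_bound (R : realType) (n m : nat) (A : 'M[R]_(n, m)) :
  exists2 c : R, 0 < c & forall (d : R) (z : 'rV[R]_n), 0 <= d ->
    (forall i, (z *m A) 0 i <= d) ->
    exists2 w : 'rV[R]_n, \sum_i `|w 0 i| <= c * d &
      forall i, ((z - w) *m A) 0 i <= 0.
Proof.
(* [D J] is [A] with the columns outside [J] set to zero. *)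
pose D (J : {set 'I_m}) := A *m diag_mx (\row_j (j \in J)%:R).
pose G J := pinvmx (D J).
pose size1 p q (B : 'M[R]_(p, q)) := \sum_i \sum_j `|B j i|.
have size1_ge0 p q (B : 'M[R]_(p, q)) : 0 <= size1 p q B.
  by apply: sumr_ge0 => i _; apply: sumr_ge0.
(* The set [F k] used below depends on [z], so the constants cover all [J]; the summand 1 makes
   powers of [C1] nondecreasing. *)
pose C1 := 1 + \sum_J size1 _ _ (G J *m A).
pose C2 := 1 + \sum_J size1 _ _ (G J).
have C1_ge1 : 1 <= C1 by rewrite lerDl sumr_ge0.
have C2_ge1 : 1 <= C2 by rewrite lerDl sumr_ge0.
have C1_gt0 : 0 < C1 by apply: lt_le_trans C1_ge1.
have C2_gt0 : 0 < C2 by apply: lt_le_trans C2_ge1.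
have GA_le J : size1 _ _ (G J *m A) <= C1.
  by rewrite /C1 (bigD1 J)//= addrCA lerDl addr_ge0// sumr_ge0.
have G_le J : size1 _ _ (G J) <= C2.
  by rewrite /C2 (bigD1 J)//= addrCA lerDl addr_ge0// sumr_ge0.
exists (C1 ^+ m * C2) => [|d z d0 zA]; first by rewrite mulr_gt0// exprn_gt0.
pose F k := [set i | - (C1 ^+ k * d) <= (z *m A) 0 i]%SET.
have d_mono k : C1 ^+ k * d <= C1 ^+ k.+1 * d.
  by rewrite ler_wpM2r// ler_weXn2l.
have F_mono k : F k \subset F k.+1.
  by apply/fintype.subsetP => i; rewrite !inE; apply: le_trans; rewrite lerN2.
have [k] := nondecreasing_sets_stabilize _ F F_mono.
rewrite card_ord => km Fk.
pose v := z *m D (F k).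
have DE i (y : 'rV[R]_n) J : (y *m D J) 0 i = (y *m A) 0 i * (i \in J)%:R.
  by rewrite mulmxA mul_mx_diag !mxE.
have v_le j : `|v 0 j| <= C1 ^+ k * d.
  rewrite DE; case jF: (j \in F k); last first.
    by rewrite mulr0 normr0 mulr_ge0// exprn_ge0// ltW.
  rewrite mulr1 ler_norml; move: jF; rewrite inE => -> /=.
  by apply: le_trans (zA j) _; rewrite ler_peMl// exprn_ege1.
pose w := v *m G (F k).
exists w.
  apply: (le_trans (row_mulmx_bound _ _ _ _ _ _ v_le)).
  rewrite [leRHS]mulrAC; apply: ler_pM (size1_ge0 _ _ _) _ (G_le _).
    by rewrite mulr_ge0// exprn_ge0// ltW.
  by rewrite ler_wpM2r// ler_weXn2l.
move=> i; have [iF|iF] := boolP (i \in F k).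
  (* [v] lies in the row space of [D (F k)], so the pseudo-inverse solves the equations exactly. *)
  have : (w *m D (F k)) 0 i = v 0 i.
    by rewrite /w mulmxKpV// submxMl.
  by rewrite /v !DE iF !mulr1 mulmxBl !mxE => ->; rewrite subrr.
rewrite mulmxBl !mxE subr_le0.
have wA : `|(w *m A) 0 i| <= C1 ^+ k.+1 * d.
  have := row_mulmx_bound _ _ _ _ (G (F k) *m A) _ v_le.
  rewrite mulmxA -/w (bigD1 i)//= => wA.
  apply: (le_trans (le_trans _ wA)); first by rewrite lerDl sumr_ge0.
  rewrite exprS -mulrA [leLHS]mulrC ler_wpM2r//.
    by rewrite mulr_ge0// exprn_ge0// ltW.
  exact: GA_le.
(* Outside [F k = F k.+1], the value of [z] is below [- (C1 ^+ k.+1 * d)], and that of [w] cannot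
   be. *)
move: iF; rewrite Fk inE -ltNge => /ltW /le_trans; rewrite !mxE; apply.
by move: wA; rewrite mxE ler_norml => /andP[].
Qed.

(** * Norms and scalar products *)

Lemma coord_le_mx_norm (R : realType) (n : nat) (x : 'rV[R]_n) i :
  `|x 0 i| <= `|x|.
Proof.
rewrite [leRHS]/Num.norm/= mx_normrE.
exact: (le_bigmax (0 : R) (fun ij => `|x ij.1 ij.2|) (ord0, i)).
Qed.

Lemma coord_le_enorm (R : realType) (n : nat) (x : 'rV[R]_n) i :
  `|x 0 i| <= enorm x.
Proof.
rewrite -sqrtr_sqr ler_wsqrtr// /dotv (bigD1 i)//= -expr2 lerDl sumr_ge0//.
by move=> j _; rewrite -expr2 sqr_ge0.
Qed.

Lemma enorm_le_sum (R : realType) (n : nat) (x : 'rV[R]_n) :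
  enorm x <= \sum_i `|x 0 i|.
Proof.
have S0 : 0 <= \sum_i `|x 0 i| by apply: sumr_ge0.
rewrite -[leRHS]ger0_norm// -sqrtr_sqr ler_wsqrtr// expr2 mulr_suml.
apply: ler_sum => i _; apply: (le_trans (ler_norm _)).
by rewrite normrM ler_wpM2l// (bigD1 i)//= lerDl sumr_ge0.
Qed.

Lemma enormZ (R : realType) (n : nat) (r : R) (x : 'rV[R]_n) :
  enorm (r *: x) = `|r| * enorm x.
Proof.
rewrite /enorm -sqrtr_sqr -sqrtrM ?sqr_ge0//; congr Num.sqrt.
by rewrite /dotv mulr_sumr; apply: eq_bigr => i _; rewrite !mxE mulrACA.
Qed.

Lemma scale_unit_eballE (R : realType) (n : nat) (r : R) (x : 'rV[R]_n) :
  0 < r -> scale_set r (@unit_eball R n) x <-> enorm x <= r.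
Proof.
move=> r0; split=> [[y /= y1 <-]|xr].
  by rewrite enormZ gtr0_norm// ler_piMr// ltW.
exists (r^-1 *: x); last by rewrite scalerA mulfV ?gt_eqF// scale1r.
by rewrite /unit_eball/= enormZ gtr0_norm ?invr_gt0// ler_pdivrMl// mulr1.
Qed.

Lemma dotv_row_mulmx (R : realType) (n m : nat) (a : 'I_m -> 'rV[R]_n)
    (z : 'rV[R]_n) i :
  (z *m \matrix_(j, k) a k 0 j) 0 i = dotv (a i) z.
Proof. by rewrite mxE; apply: eq_bigr => j _; rewrite mxE mulrC. Qed.

Lemma dotvDr (R : realType) (n : nat) (a x y : 'rV[R]_n) :
  dotv a (x + y) = dotv a x + dotv a y.
Proof. by rewrite -big_split; apply: eq_bigr => i _; rewrite mxE mulrDr. Qed.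

Lemma dotvZr (R : realType) (n : nat) (a x : 'rV[R]_n) (r : R) :
  dotv a (r *: x) = r * dotv a x.
Proof. by rewrite mulr_sumr; apply: eq_bigr => i _; rewrite mxE mulrCA. Qed.

Lemma dotv_bound (R : realType) (n : nat) (a x : 'rV[R]_n) :
  `|dotv a x| <= (\sum_j `|a 0 j|) * `|x|.
Proof.
rewrite mulr_suml; apply: le_trans (ler_norm_sum _ _ _) _.
by apply: ler_sum => j _; rewrite normrM ler_wpM2l// coord_le_mx_norm.
Qed.

(** * Recession cones *)

Lemma recession_coneZ (R : realType) (n : nat) (C : set 'rV[R]_n) (r : R) d :
  0 <= r -> recession_cone C d -> recession_cone C (r *: d).
Proof.
by move=> r0 Cd x mu Cx mu0; rewrite scalerA; apply: Cd => //; rewrite mulr_ge0.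
Qed.

Lemma polyhedral_recession_coneE (R : realType) (n : nat) (C : set 'rV[R]_n) :
  polyhedral (recession_cone C) ->
  exists (m : nat) (a : 'I_m -> 'rV[R]_n),
    forall d, recession_cone C d <-> forall i, dotv (a i) d <= 0.
Proof.
move=> [m [a [b [_ CE]]]]; exists m, a => d; split=> [Cd i|ad].
  have ad_le r : 0 <= r -> r * dotv (a i) d <= b i.
    move=> r0; have := recession_coneZ _ _ C r d r0 Cd.
    by rewrite CE => /(_ i I); rewrite /halfspace/= dotvZr.
  rewrite leNgt; apply/negP => ad0.
  have b0 : 0 <= b i by have := ad_le 0 (lexx 0); rewrite mul0r.
  (* This multiple of [d] would give the product [b i + 1], beyond the offset [b i]. *)
  have := ad_le ((b i + 1) / dotv (a i) d) (divr_ge0 (addr_ge0 b0 ler01) (ltW ad0)).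
  by rewrite divfK ?gt_eqF// gerDl ler10.
have C0 : recession_cone C 0 by move=> x mu Cx _; rewrite scaler0 addr0.
rewrite CE => i _; apply: (le_trans (ad i)).
move: C0; rewrite CE => /(_ i I); rewrite /halfspace/=.
by rewrite -[X in dotv _ X](scale0r 0) dotvZr mul0r.
Qed.

(** * The two implications *)

Lemma hyperbolic_of_approx_M_decomposable (R : realType) (n : nat)
    (C : set 'rV[R]_n) :
  approx_M_decomposable C -> hyperbolic C.
Proof.
move=> /(_ 1 ltr01)[r r0 Cr].
(* A cube containing the ball of radius [r + 1], compact as a product of segments. *)
exists [set v | forall i, `[- (r + 1), r + 1]%classic (v ord0 i)]; split.
- by apply: (@rV_compact _ _ (fun=> `[- (r + 1), r + 1]%classic)) => i;
    exact: segment_compact.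
- move=> x y l /set_mem/= xM /set_mem/= yM; apply/mem_set => i /=.
  have := xM i; have := yM i; rewrite /= !in_itv/= !mxE -!ler_norml => yi xi.
  have l1 : 0 <= 1 - l%:num by rewrite subr_ge0.
  apply: (le_trans (ler_normD _ _)); rewrite !normrM.
  rewrite [`|l%:num|]ger0_norm// [`|1 - _|]ger0_norm//.
  rewrite (_ : r + 1 = l%:num * (r + 1) + (1 - l%:num) * (r + 1)); last by ring.
  by rewrite lerD// ler_wpM2l.
- move=> x /Cr[_ [y [Cy yr] [k Ck <-]] [w w1 <-]].
  exists (y + w); last by exists k => //; rewrite addrAC.
  move=> i /=; rewrite in_itv/= mxE -ler_norml.
  apply: (le_trans (ler_normD _ _)); apply: lerD.
    by apply: le_trans (coord_le_enorm _ _ _ _) _; exact/scale_unit_eballE.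
  by apply: le_trans (coord_le_enorm _ _ _ _) _; exact/scale_unit_eballE.
Qed.

Lemma approx_M_decomposable_of_hyperbolic (R : realType) (n : nat)
    (C : set 'rV[R]_n) :
  polyhedral (recession_cone C) -> hyperbolic C -> approx_M_decomposable C.
Proof.
move=> /polyhedral_recession_coneE[m [a CE]] [M [M_compact _ CM]] e e0.
have [rho [_ rhoM]] := compact_bounded M_compact.
have {rhoM}Mrho x : M x -> `|x| <= rho + 1.
  by move=> Mx; apply: rhoM Mx; rewrite ltrDl.
apply: contrapT => noCr.
have /choice[x xP] : forall k : nat, exists x, C x /\
    ~ Defs.msum (truncation C k.+1%:R) (scale_set e (@unit_eball R n)) x.
  move=> k; apply: contrapT => nox; apply: noCr; exists k.+1%:R => // y Cy.
  by apply: contrapT => ny; apply: nox; exists y.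
have [c c0 hoff] := hoffman_bound R n m (\matrix_(j, k) a k 0 j).
pose u i k := - dotv (a i) (x k).
(* Summing over [i] gives one lower bound for all the sequences [u i]. *)
pose b := - \sum_i (\sum_j `|a i 0 j|) * (rho + 1).
have ub i k : b <= u i k.
  have [y My [d Cd xE]] := CM _ (xP k).1.
  have rho0 : 0 <= rho + 1 by apply: le_trans (Mrho _ My).
  rewrite lerN2 -xE dotvDr; apply: (@le_trans _ _ (dotv (a i) y)).
    by rewrite gerDl; exact: (CE d).1 Cd i.
  apply: (le_trans (ler_norm _)); apply: (le_trans (dotv_bound _ _ _ _)).
  apply: (@le_trans _ _ ((\sum_j `|a i 0 j|) * (rho + 1))).
    by rewrite ler_wpM2l ?sumr_ge0// Mrho.
  rewrite (bigD1 i)//= lerDl sumr_ge0// => k' _.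
  by rewrite mulr_ge0// sumr_ge0.
(* With error [e / c], Hoffman's corrector has norm at most [e]. *)
have ec0 : 0 < e / c by rewrite divr_gt0.
have [f f_homo fu] := almost_nondecreasing_common_subseq R _ u b (e / c)
  (enum 'I_m) ub ec0.
pose y := x (f 0%N).
have [N yN] : exists N : nat, enorm y <= N.+1%:R.
  have [N yN] : exists N : nat, enorm y <= N%:R.
    by exists (Num.bound (enorm y)); rewrite ltW// archi_boundP// sqrtr_ge0.
  by exists N; apply: (le_trans yN); rewrite ler_nat.
have fN : (N < f N.+1)%N.
  elim: (N) => [|k IH]; first by apply: leq_ltn_trans (f_homo 0 1 _)%N.
  by apply: leq_ltn_trans IH _; exact: f_homo.
have [|i|w wle zw] := hoff (e / c) (x (f N.+1) - y); first exact: ltW.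
  have := fu i 0%N N.+1 (mem_enum _ _) isT.
  by rewrite dotv_row_mulmx -scaleN1r dotvDr dotvZr /u mulN1r -/y; lra.
(* The point splits into [y] in the ball, a recession direction, and the corrector [w] in [e] times
   the unit ball. *)
apply: (xP (f N.+1)).2; exists (y + (x (f N.+1) - y - w)).
  exists y.
    split; first exact: (xP _).1.
    apply/scale_unit_eballE => //; apply: (le_trans yN); rewrite ler_nat.
    by rewrite ltnS ltnW.
  exists (x (f N.+1) - y - w) => //; apply/CE => i.
  by rewrite -dotv_row_mulmx.
exists w; last by rewrite -addrA subrK addrC subrK.
apply/scale_unit_eballE => //; apply: (le_trans (enorm_le_sum _ _ _)).
by move: wle; rewrite mulrC divfK// gt_eqF.
Qed.

Theorem corollary3p14 (R : realType) (n : nat) (C : set 'rV[R]_n)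
  (C_nonempty : C !=set0) (C_closed : closed C) (C_convex : convex_set C)
  (C_rec_polyhedral : polyhedral (recession_cone C)) :
  approx_M_decomposable C <-> hyperbolic C.
Proof.
split; first exact: hyperbolic_of_approx_M_decomposable.
exact: approx_M_decomposable_of_hyperbolic.
Qed.
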